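(* Let $\Gamma=(N,(Y_i)_{i\in N},u)$ be a finite normal form game in which all players have the identical utility function $u$. Let $\mathcal{C}=\{C_1,\ldots,C_m\}$ be a permutation-invariant partition of the player set $N$. Let $\{\gamma_t\}_{t\ge 1}$ satisfy $\gamma_t\ge 0$ for all $t$, $\sum_{t\ge1}\gamma_t=\infty$ and $\lim_{t\to\infty}\gamma_t=0$, and let $\{\epsilon_t\}_{t\ge1}$, $\epsilon_t\ge0$, satisfy $\lim_{t\to\infty}\epsilon_t=0$. Let $\{q(t),\bar q(t)\}_{t\ge1}$ be a discrete-time ECFP process with respect to $(\Gamma,\mathcal{C})$ with step sizes $\{\gamma_t\}$ and best-response errors $\{\epsilon_t\}$. Then: (i) $\lim_{t\to\infty} d(q(t),MCE)=0$; (ii) $\lim_{t\to\infty} d(\bar q(t),SNE)=0$.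
   Context: Game. $N=\{1,\ldots,n\}$ is the set of players; $Y_i$ is the finite action set of player $i$, of cardinality $m_i$; $Y=\prod_{i=1}^n Y_i$; $u:Y\to\mathbb{R}$ is the common utility. $\Delta_i=\{p\in\mathbb{R}^{m_i}:\sum_k p(k)=1,\ p(k)\ge 0\ \forall k\}$ is the set of mixed strategies of player $i$ and $\Delta^n=\prod_{i=1}^n\Delta_i$. The mixed utility is $U(p_1,\ldots,p_n)=\sum_{y\in Y}u(y)p_1(y_1)\cdots p_n(y_n)$ for $p\in\Delta^n$. Write $p=(p_i,p_{-i})$, where $p_{-i}$ is the profile of all players other than $i$. Best responses. For $\epsilon\ge0$, $BR_i^\epsilon(p_{-i})=\{p_i\in\Delta_i: U(p_i,p_{-i})\ge\max_{\alpha_i\in\Delta_i}U(\alpha_i,p_{-i})-\epsilon\}$ and $BR^\epsilon(p)=BR_1^\epsilon(p_{-1})\times\cdots\times BR_n^\epsilon(p_{-n})$. Permutation-invariant partition. A collection $\mathcal{C}=\{C_1,\ldots,C_m\}$ of subsets of $N$ (index set $I=\{1,\ldots,m\}$) such that: the $C_k$ are pairwise disjoint with union $N$; if $i,j\in C_k$ then $Y_i=Y_j$; and for all $k\in I$, $i,j\in C_k$, $y\in Y$, the value $u(y)$ is unchanged when the actions of players $i$ and $j$ (only) in $y$ are interchanged. Let $\phi(i)=k$ iff $i\in C_k$. Centroid. For $p\in\Delta^n$, $\bar p^k=|C_k|^{-1}\sum_{i\in C_k}p_i$, $\bar p_i=\bar p^{\phi(i)}$, $\bar p=(\bar p_1,\ldots,\bar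 p_n)$. Equilibria. $NE=\{p\in\Delta^n: U(p_i,p_{-i})\ge U(p_i',p_{-i})\ \forall p_i'\in\Delta_i,\ \forall i\}$; $SNE=\{p\in NE: p_i=p_j\ \forall i,j\in C_k,\ \forall k\in I\}$; $MCE=\{p\in\Delta^n: U(p_i,\bar p_{-i})\ge U(p_i',\bar p_{-i})\ \forall p_i'\in\Delta_i,\ \forall i\}$. Discrete-time ECFP process. Joint actions $a(t)=(a_1(t),\ldots,a_n(t))\in\Delta^n$, $t\ge1$, with $a(1)$ arbitrary; empirical distributions $q_i(1)=a_i(1)$ and $q_i(t+1)=q_i(t)+\gamma_t(a_i(t+1)-q_i(t))$ for $t\ge1$, with $q(t)=(q_1(t),\ldots,q_n(t))\in\Delta^n$ for all $t$; and $a(t+1)\in BR^{\epsilon_t}(\bar q(t))$ for all $t\ge1$, where $\bar q(t)$ is the centroid of $q(t)$. The pair sequence $\{q(t),\bar q(t)\}_{t\ge1}$ is then a discrete-time ECFP process. $d(x,A)=\inf_{y\in A}\|x-y\|$ denotes the distance from a point to a set. *)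

(* Defs.v *)
From HB Require Import structures.
From mathcomp Require Import all_boot all_order all_algebra all_fingroup.
From mathcomp Require Import all_classical all_reals all_analysis.

Set Implicit Arguments.
Unset Strict Implicit.
Unset Printing Implicit Defensive.

Import Order.TTheory GRing.Theory Num.Theory.
Import numFieldNormedType.Exports.

Local Open Scope classical_set_scope.
Local Open Scope ring_scope.

(* The finite action sets [Y i] are subsets of one finite type [A], so that   *)
(* [Y i = Y j] and the interchange of actions are meaningful without casts.   *)
(* The values of the utility [u] outside [joint_actions Y] are never used.    *)

Definition profile (R : realType) (n : nat) (A : finType) : Type :=
  'I_n -> A -> R.

Section Game.
Context {R : realType} {n : nat} {A : finType}.
Implicit Types (Y : 'I_n -> {set A}) (u : {ffun 'I_n -> A} -> R).

Definition joint_actions Y : {set {ffun 'I_n -> A}} :=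
  [set y : {ffun 'I_n -> A} | [forall i, y i \in Y i]]%SET.

(* R^(m_i) is identified with the functions [A -> R] vanishing outside [Y i]. *)
Definition Delta Y (i : 'I_n) : set (A -> R) :=
  [set p | [/\ \sum_(a in Y i) p a = 1,
               forall a, a \in Y i -> 0 <= p a
             & forall a, a \notin Y i -> p a = 0]].

Local Notation profile := (profile R n A).
Implicit Types p q : profile.

Definition DeltaN Y : set profile := [set p | forall i, Delta Y i (p i)].

Definition U Y u p : R :=
  \sum_(y in joint_actions Y) u y * \prod_(i < n) p i (y i).

(* The profile (x, p_{-i}); it does not depend on the component [p i]. *)
Definition repl p (i : 'I_n) (x : A -> R) : profile := dfwith p i x.

(* The continuous function U(., p_{-i}) attains its supremum on the compact   *)
(* set Delta_i, so [sup] is the maximum (Delta_i is nonempty in every use).   *)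
Definition BRi Y u (eps : R) (i : 'I_n) p : set (A -> R) :=
  [set x | Delta Y i x /\
     U Y u (repl p i x) >=
       sup [set U Y u (repl p i alpha) | alpha in Delta Y i] - eps].

Definition BR Y u (eps : R) p : set profile :=
  [set b | forall i, BRi Y u eps i p (b i)].

Definition swap_actions (i j : 'I_n) (y : {ffun 'I_n -> A}) :
  {ffun 'I_n -> A} := [ffun l => y (tperm i j l)].

Definition perm_invariant_partition Y u (C : {set {set 'I_n}}) : Prop :=
  [/\ finset.partition C [set: 'I_n]%SET,
      forall B i j, B \in C -> i \in B -> j \in B -> Y i = Y j
    & forall B i j y, B \in C -> i \in B -> j \in B ->
        y \in joint_actions Y -> u (swap_actions i j y) = u y].

Definition block_mean p (B : {set 'I_n}) : A -> R :=
  fun a => #|B|%:R^-1 * \sum_(i in B) p i a.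

(* [pblock C i] is the block C_phi(i) containing player [i]. *)
Definition centroid (C : {set {set 'I_n}}) p : profile :=
  fun i => block_mean p (finset.pblock C i).

Definition NE Y u : set profile :=
  [set p | DeltaN Y p /\
     forall i x, Delta Y i x -> U Y u p >= U Y u (repl p i x)].

Definition SNE Y u (C : {set {set 'I_n}}) : set profile :=
  [set p | NE Y u p /\
     forall B i j, B \in C -> i \in B -> j \in B -> p i = p j].

Definition MCE Y u (C : {set {set 'I_n}}) : set profile :=
  [set p | DeltaN Y p /\
     forall i x, Delta Y i x ->
       U Y u (repl (centroid C p) i (p i)) >= U Y u (repl (centroid C p) i x)].

(* Time starts at 1: the values at 0 of all sequences are irrelevant.  Since  *)
(* gamma_t may exceed 1, q(t) being a mixed profile is a genuine requirement. *)
Definition discrete_ECFP Y u (C : {set {set 'I_n}}) (gamma eps : nat -> R)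
    (q qbar : nat -> profile) : Prop :=
  exists a : nat -> profile,
    [/\ forall t, (1 <= t)%N -> DeltaN Y (a t) /\ DeltaN Y (q t),
        q 1%N = a 1%N,
        forall t, (1 <= t)%N -> forall i x,
          q t.+1 i x = q t i x + gamma t * (a t.+1 i x - q t i x),
        forall t, (1 <= t)%N -> qbar t = centroid C (q t)
      & forall t, (1 <= t)%N -> BR Y u (eps t) (qbar t) (a t.+1)].

Definition l2dist p q : R :=
  Num.sqrt (\sum_(i < n) \sum_(a : A) (p i a - q i a) ^+ 2).

(* Extended-real infimum, so that the distance to the empty set is [+oo]      *)
(* (the real-valued [inf] would make it 0).                                   *)
Definition dist_set p (S : set profile) : \bar R :=
  ereal_inf [set (l2dist p s)%:E | s in S].

End Game.

(* Main.v *)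
Require Import Defs.
From HB Require Import structures.
From mathcomp Require Import all_boot all_order all_algebra all_fingroup.
From mathcomp Require Import all_classical all_reals all_analysis.
From mathcomp Require Import ring lra.

Set Implicit Arguments.
Unset Strict Implicit.
Unset Printing Implicit Defensive.

Import Order.TTheory GRing.Theory Num.Theory.
Import numFieldNormedType.Exports.

Local Open Scope classical_set_scope.
Local Open Scope ring_scope.

(* Write [gap p] for the total gain available from unilateral deviations at
   [p].  Along the process, permutation invariance turns the responses of the
   players of a block against the centroid into a response of the centroid
   itself, so [v t := U (centroid (q t))] increases by at least
   [gamma_t * (gap - o(1))], with no summability of [gamma_t ^ 2].  This forces
   [v] to converge, and then [gap (centroid (q t))] to tend to [0], provided that
   the values of [U] on equilibria contain no interval; compactness concludes,
   as the zeros of [gap \o centroid] are mean-centric equilibria whose centroids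
   are symmetric equilibria.

   The Sard-type fact on equilibrium values is algebraic.  If each [c] in an
   interval were the value of an equilibrium [p c], then, modulo an
   ultrafilter, the germs of the coordinates [p c i a] would generate, with the
   transcendental germ [c], a domain carrying a derivation [D] with [D c = 1].
   The complementarity conditions of equilibria give [D (U p) = 0], although
   [U p = c]. *)

(** * Dual numbers and extension of derivations *)

(* [(b, d)] stands for [b + d eps] with [eps ^ 2 = 0].  Only the additive structure
   of the product is inherited: its componentwise multiplication is not the one
   used here. *)
Definition dual (B : comNzRingType) : Type := (B * B)%type.
HB.instance Definition _ (B : comNzRingType) := GRing.Zmodule.copy (dual B) (B * B)%type.

Section DualRing.
Variable B : comNzRingType.
Implicit Types x y z : dual B.

Definition dual_one : dual B := (1, 0).
Definition dual_mul x y : dual B := (x.1 * y.1, x.1 * y.2 + x.2 * y.1).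

Fact dual_mulA : associative dual_mul.
Proof. by move=> x y z; congr pair => /=; ring. Qed.
Fact dual_mulC : commutative dual_mul.
Proof. by move=> x y; congr pair => /=; ring. Qed.
Fact dual_mul1 : left_id dual_one dual_mul.
Proof. by move=> [a b]; congr pair => /=; ring. Qed.
Fact dual_mulDl : left_distributive dual_mul +%R.
Proof. by move=> x y z; congr pair => /=; ring. Qed.
Fact dual_one_neq0 : dual_one != 0.
Proof. by apply/eqP => -[/eqP]; rewrite oner_eq0. Qed.

HB.instance Definition _ := GRing.Zmodule_isComNzRing.Build (dual B)
  dual_mulA dual_mulC dual_mul1 dual_mulDl dual_one_neq0.

Lemma dualD1 x y : (x + y).1 = x.1 + y.1. Proof. by []. Qed.
Lemma dualD2 x y : (x + y).2 = x.2 + y.2. Proof. by []. Qed.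
Lemma dualM1 x y : (x * y).1 = x.1 * y.1. Proof. by []. Qed.
Lemma dualM2 x y : (x * y).2 = x.1 * y.2 + x.2 * y.1. Proof. by []. Qed.
Lemma dualN2 x : (- x).2 = - x.2. Proof. by []. Qed.

(** First-order Taylor expansion, exact because [eps ^ 2 = 0]. *)
Lemma horner_dual (P : {poly dual B}) (a b : B) :
  P.[(a, b) : dual B] =
  P.[(a, 0) : dual B] + ((0, (P^`().[(a, 0) : dual B]).1 * b) : dual B).
Proof.
elim/poly_ind: P => [|P c IH]; first by rewrite deriv0 !horner0 /= mul0r addr0.
rewrite derivD derivM derivX derivC addr0 mulr1 !hornerD !hornerM !hornerX !hornerC IH.
by congr pair; rewrite /= ?(dualD1, dualM1, dualD2, dualM2) /=; ring.
Qed.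

End DualRing.

Section DerivationExtension.
(** Under these hypotheses [B] modulo the ideal [N] behaves as a field of characteristic zero; the
    quotient itself is never formed. *)
Variables (B : comNzRingType) (N : B -> Prop).
Hypothesis ND : forall a b, N a -> N b -> N (a + b).
Hypothesis NM : forall a b, N b -> N (a * b).
Hypothesis Nprime : forall a b, N (a * b) -> N a \/ N b.
Hypothesis Ninv : forall a, ~ N a -> exists b, N (a * b - 1).
Hypothesis Nchar0 : forall a k, N (a *+ k.+1) -> N a.
Hypothesis N0 : N 0.

(* A ring morphism into the dual numbers is a derivation along its first
   component; compatibility makes it well defined on the image modulo [N]. *)
Definition derivation_compat (F : comNzRingType) (phi : F -> dual B) :=
  forall f, N (phi f).1 -> N (phi f).2.

Let NN a : N a -> N (- a).
Proof. by move=> /(NM (-1)); rewrite mulN1r. Qed.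
Let NB a b : N a -> N b -> N (a - b).
Proof. by move=> Na /NN; exact: ND. Qed.
Let NDr a b : N b -> N (a + b) -> N a.
Proof. by move=> Nb /NB/(_ Nb); rewrite addrK. Qed.
Let NMr a b : N a -> N (a * b).
Proof. by rewrite mulrC; exact: NM. Qed.

Section Extend.
Variables (F : comNzRingType) (phi : {rmorphism F -> dual B}).
Hypothesis phiN : derivation_compat phi.
Variable x : B.

(** With all of [{poly F}] as source this is a morphism for every [d]; the algebraic relations of
    [x] enter only through [derivation_compat]. *)
Definition poly_ext (d : B) : {rmorphism {poly F} -> dual B} :=
  (horner_eval ((x, d) : dual B) \o map_poly phi).

Let extC d c : poly_ext d c%:P = phi c.
Proof. by rewrite /= /horner_eval map_polyC hornerC. Qed.

Let extZ d c P : poly_ext d (c *: P) = phi c * poly_ext d P.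
Proof. by rewrite -mul_polyC rmorphM extC. Qed.

Let ext1 d (P : {poly F}) : (poly_ext d P).1 = (poly_ext 0 P).1.
Proof. by rewrite /= /horner_eval horner_dual dualD1 /= addr0. Qed.

Let ext2 d (P : {poly F}) :
  (poly_ext d P).2 = (poly_ext 0 P).2 + (poly_ext 0 P^`()).1 * d.
Proof. by rewrite /= /horner_eval horner_dual deriv_map. Qed.

Let annihilates k (m : {poly F}) :=
  [/\ (size m <= k.+1)%N, ~ N (phi m`_k).1 & N (poly_ext 0 m).1].

(** By [phiN] a null leading coefficient has a null derivative, so removing its monomial changes
    neither component modulo [N]. *)
Let drop_lead k d (P : {poly F}) : (size P <= k.+1)%N -> N (phi P`_k).1 ->
  exists Q : {poly F}, [/\ (size Q <= k)%N,
    N (poly_ext d Q - poly_ext d P).1 & N (poly_ext d Q - poly_ext d P).2].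
Proof.
move=> sP NPk; exists (P - P`_k *: 'X^k); split.
- apply/leq_sizeP => j; rewrite leq_eqVlt => /predU1P[<-|kj].
    by rewrite coefB coefZ coefXn eqxx mulr1 subrr.
  rewrite coefB coefZ coefXn gtn_eqF // mulr0 subr0.
  by move/leq_sizeP: sP; apply.
- rewrite -rmorphB addrAC subrr add0r rmorphN extZ.
  by apply: NN; exact: NMr.
- rewrite -rmorphB addrAC subrr add0r rmorphN extZ.
  apply: NN; apply: ND; first exact: NMr.
  by apply: NMr; exact: phiN.
Qed.

(* If [x] is transcendental over the image modulo [N], any [d] works; otherwise
   [d] solves the equation obtained by differentiating a relation of minimal
   degree, whose derivative is not null in characteristic zero. *)
Lemma extend_derivation : exists d, derivation_compat (poly_ext d).
Proof.
have [[k0 [m0 am0]]|noann] := pselect (exists k m, annihilates k m); last first.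
  exists 0 => P; elim: {P}(size P) {-2}P (leqnn (size P)) => [P|k IH P sP NP].
    by rewrite leqn0 size_poly_eq0 => /eqP -> _; rewrite rmorph0.
  have NPk : N (phi P`_k).1.
    by apply: contrapT => nN; apply: noann; exists k, P.
  have [Q [sQ NQ1 NQ2]] := drop_lead 0 sP NPk.
  have NQ : N (poly_ext 0 Q).1 by move: (ND NQ1 NP); rewrite -dualD1 subrK.
  have := NB (IH _ sQ NQ) NQ2.
  by rewrite -dualN2 -dualD2 opprB addrC subrK.
have : exists k, `[< exists m, annihilates k m >] by exists k0; apply/asboolP; exists m0.
case/ex_minnP => j /asboolP[m [sm nNm Nm]] jmin.
(* Otherwise the derivative of [m] would be a relation of smaller degree: its leading coefficient is
   [j] times that of [m], hence not null. *)
have nNm' : ~ N (poly_ext 0 m^`()).1.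
  move=> Nm'; move: sm nNm jmin; case: j => [|i] sm nNm jmin.
    by apply: nNm; move: Nm; rewrite {1}(size1_polyC sm) extC.
  have /jmin : `[< exists m, annihilates i m >].
    apply/asboolP; exists m^`(); split => //.
      rewrite (leq_trans (size_poly _ _)) //.
      by move: sm; case: (size m).
    rewrite coef_deriv rmorphMn /= => H; apply: nNm.
    by apply: Nchar0; rewrite -[X in N X](raddfMn (@fst B B)) /=; exact: H.
  by rewrite ltnn.
have [b Nb] := Ninv nNm'.
pose d := - (poly_ext 0 m).2 * b; exists d.
have Nmd : N (poly_ext d m).2.
  rewrite ext2 /d; set s := (_.2); set e := (_.1) in Nb *.
  have -> : s + e * (- s * b) = - s * (e * b - 1) by ring.
  exact: NM.
have Nmd1 : N (poly_ext d m).1 by rewrite ext1.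
move=> P; elim: {P}(size P) {-2}P (leqnn (size P)) => [P|k IH P sP NP].
  by rewrite leqn0 size_poly_eq0 => /eqP -> _; rewrite rmorph0.
have [NPk|nNPk] := pselect (N (phi P`_k).1).
  have [Q [sQ NQ1 NQ2]] := drop_lead d sP NPk.
  have NQ : N (poly_ext d Q).1 by move: (ND NQ1 NP); rewrite -dualD1 subrK.
  have := NB (IH _ sQ NQ) NQ2.
  by rewrite -dualN2 -dualD2 opprB addrC subrK.
have jk : (j <= k)%N.
  by apply: jmin; apply/asboolP; exists P; split; rewrite -?(ext1 d).
(* Pseudo-division by [m]: cross-multiplication kills degree [k], and the factor coming from the
   leading coefficient of [m] is cancelled at the end by [Nprime]. *)
pose Q := m`_j *: P - P`_k *: ('X^(k - j) * m).
have sQ : (size Q <= k)%N.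
  apply/leq_sizeP => i; rewrite leq_eqVlt => /predU1P[<-|ki].
    rewrite coefB !coefZ coefXnM ltnNge leq_subr /= subKn //.
    by rewrite mulrC subrr.
  rewrite coefB !coefZ coefXnM ltnNge (leq_trans (leq_subr _ _) (ltnW ki)) /=.
  rewrite (leq_sizeP _ _ sP) // mulr0 (leq_sizeP _ _ sm) ?mulr0 ?subr0 //.
  by rewrite ltn_subRL subnK.
have EQ : poly_ext d Q = phi m`_j * poly_ext d P
    - phi P`_k * (poly_ext d 'X^(k - j) * poly_ext d m).
  by rewrite /Q rmorphB !extZ rmorphM.
have NQ1 : N (poly_ext d Q).1.
  by rewrite EQ; apply: NB; apply: NM => //; exact: NM.
have NQ2 := IH _ sQ NQ1.
have Nrest : N ((phi P`_k * (poly_ext d 'X^(k - j) * poly_ext d m)).2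
    - (phi m`_j).2 * (poly_ext d P).1).
  apply: NB; last exact: NM.
  rewrite !dualM2 dualM1.
  by apply: ND; [apply/NM/ND; apply: NM|apply/NM/NM].
have /Nprime[//|//] : N ((phi m`_j).1 * (poly_ext d P).2).
  move: (ND NQ2 Nrest); rewrite EQ dualD2 dualN2 addrA subrK.
  by rewrite [X in X - _]dualM2 addrK.
Qed.

End Extend.

Section Constants.
Variables (K : comNzRingType) (k : {rmorphism K -> B}).

Definition dual_const (r : K) : dual B := (k r, 0).

Fact dual_const_zmod_morphism : zmod_morphism dual_const.
Proof. by move=> a b; congr pair; rewrite /= ?rmorphB ?subr0. Qed.
Fact dual_const_monoid_morphism : monoid_morphism dual_const.
Proof.
split; first by congr pair; rewrite rmorph1.
by move=> a b; congr pair; rewrite /= ?rmorphM // mulr0 mul0r addr0.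
Qed.
HB.instance Definition _ :=
  GRing.isZmodMorphism.Build K (dual B) dual_const dual_const_zmod_morphism.
HB.instance Definition _ :=
  GRing.isMonoidMorphism.Build K (dual B) dual_const dual_const_monoid_morphism.

Lemma horner_dual_const (P : {poly K}) (c d : B) :
  (map_poly dual_const P).[(c, d) : dual B].1 = (map_poly k P).[c].
Proof.
elim/poly_ind: P => [|P a IH]; first by rewrite !rmorph0 !horner0.
rewrite !rmorphD !rmorphM /= !map_polyX !map_polyC !hornerMXaddC.
by rewrite dualD1 dualM1 IH.
Qed.

(** The elements of [xs] are adjoined one at a time, so [F] is an iterated polynomial ring. In the
    base case the indeterminate goes to [(c, 1)], and compatibility is the transcendence of [c]. *)
Lemma exists_derivation (c : B) (xs : seq B) :
  (forall P : {poly K}, N (map_poly k P).[c] -> P = 0) ->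
  exists (F : comNzRingType) (phi : {rmorphism F -> dual B}),
  [/\ derivation_compat phi,
      forall r, exists f, phi f = (k r, 0),
      exists f, phi f = (c, 1)
    & forall x, x \in xs -> exists f d, phi f = (x, d)].
Proof.
move=> transc; elim: xs => [|x xs [F [phi [Nphi phik [fc phic] phixs]]]].
  exists {poly K}, (horner_eval ((c, 1) : dual B) \o map_poly dual_const).
  split=> [P|r||//].
  - by rewrite /= /horner_eval horner_dual_const => /transc ->; rewrite rmorph0 horner0.
  - by exists r%:P; rewrite /= /horner_eval map_polyC hornerC.
  - by exists 'X; rewrite /= /horner_eval map_polyX hornerX.
have [d Nd] := extend_derivation Nphi x.
have extC a : poly_ext phi x d a%:P = phi a.
  by rewrite /= /horner_eval map_polyC hornerC.
exists {poly F}, (poly_ext phi x d); split=> // [r||y].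
- by have [f <-] := phik r; exists f%:P.
- by exists fc%:P; rewrite extC.
- rewrite inE => /predU1P[->|/phixs[f [e fe]]]; last first.
    by exists f%:P, e; rewrite extC.
  by exists 'X, d; rewrite /= /horner_eval map_polyX hornerX.
Qed.

End Constants.
End DerivationExtension.

(** * Equilibrium values contain no interval *)

Lemma dual_sum1 (B : comNzRingType) I (r : seq I) P (z : I -> dual B) :
  (\sum_(i <- r | P i) z i).1 = \sum_(i <- r | P i) (z i).1.
Proof. exact: (big_morph (fun x : dual B => x.1)). Qed.

Lemma dual_sum2 (B : comNzRingType) I (r : seq I) P (z : I -> dual B) :
  (\sum_(i <- r | P i) z i).2 = \sum_(i <- r | P i) (z i).2.
Proof. exact: (big_morph (fun x : dual B => x.2)). Qed.

Lemma dual_prod1 (B : comNzRingType) I (r : seq I) P (z : I -> dual B) :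
  (\prod_(i <- r | P i) z i).1 = \prod_(i <- r | P i) (z i).1.
Proof. exact: (big_morph (fun x : dual B => x.1)). Qed.

(** Leibniz rule; [uniq] ensures that [j != i] removes a single factor. *)
Lemma big_dual2 (B : comNzRingType) (I : eqType) (r : seq I) (z : I -> dual B) :
  uniq r -> (\prod_(i <- r) z i).2 =
            \sum_(i <- r) (z i).2 * \prod_(j <- r | j != i) (z j).1.
Proof.
elim: r => [|i r IH] /=; first by rewrite !big_nil.
move=> /andP[ir ur]; rewrite big_cons dualM2 IH // big_cons addrC; congr (_ + _).
  rewrite big_cons eqxx /= dual_prod1; congr (_ * _).
  rewrite big_seq [RHS]big_seq_cond; apply: eq_bigl => j.
  by rewrite andbC; case: eqVneq => // ->; rewrite (negPf ir).
rewrite big_distrr /= !big_seq; apply: eq_bigr => j jr.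
rewrite big_cons ifT; last by apply: contraNneq ir => ->.
by rewrite mulrCA.
Qed.

(** * Multilinearity of the utility and complementarity *)

Section GameUtility.
Variables (R : realType) (n : nat) (A : finType).
Variables (Y : 'I_n -> {set A}) (u : {ffun 'I_n -> A} -> R).
Implicit Types p : profile R n A.

Lemma repl_at p i x : repl p i x i = x.
Proof. exact: dfwithin. Qed.

Lemma repl_out p i x j : j != i -> repl p i x j = p j.
Proof. by move=> ji; apply: dfwithout; rewrite eq_sym. Qed.

Lemma U_repl p i x : U Y u (repl p i x) =
  \sum_(y in joint_actions Y) u y * (x (y i) * \prod_(j | j != i) p j (y j)).
Proof.
apply: eq_bigr => y _; congr (_ * _); rewrite (bigD1 i) //= repl_at.
by congr (_ * _); apply: eq_bigr => j ji; rewrite repl_out.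
Qed.

Definition vertex (a : A) : A -> R := fun b => (b == a)%:R.

(** Linearity in the component of player [i]; as [x] is an arbitrary function, this also covers
    tangent directions. *)
Lemma U_repl_vertex p i x :
  U Y u (repl p i x) = \sum_(a in Y i) x a * U Y u (repl p i (vertex a)).
Proof.
rewrite U_repl; under [RHS]eq_bigr do rewrite U_repl big_distrr.
rewrite exchange_big /=; apply: eq_bigr => y; rewrite inE => /forallP Yy.
rewrite (bigD1 (y i)) //= [X in _ + X]big1 ?addr0; last first.
  by move=> a /andP[_ ay]; rewrite /vertex (eq_sym (y i)) (negPf ay) mul0r !mulr0.
by rewrite /vertex eqxx mul1r mulrCA.
Qed.

Lemma U_repl_id p i : U Y u (repl p i (p i)) = U Y u p.
Proof.
apply: eq_bigr => y _; congr (_ * _); apply: eq_bigr => j _.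
by have [->|ji] := eqVneq j i; rewrite ?repl_at ?repl_out.
Qed.

Lemma Delta_vertex i a : a \in Y i -> Delta Y i (vertex a).
Proof.
move=> Ya; split=> [|b _|b]; rewrite /vertex.
- rewrite (bigD1 a) //= eqxx big1 ?addr0 // => b /andP[_].
  by move/negPf ->.
- by rewrite ler0n.
- by case: eqVneq => // ->; rewrite Ya.
Qed.

(** At an equilibrium the losses of pure deviations are nonnegative and average to zero under [p i],
    so they vanish on its support. *)
Lemma NE_complementarity p i a : NE Y u p -> a \in Y i -> p i a != 0 ->
  U Y u (repl p i (vertex a)) = U Y u p.
Proof.
move=> [Dp NEp] Ya pa; have [p1 p0 _] := Dp i.
have /eqP : \sum_(b in Y i) p i b * (U Y u p - U Y u (repl p i (vertex b))) = 0.
  under eq_bigr do rewrite mulrBr.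
  by rewrite sumrB -U_repl_vertex U_repl_id -big_distrl /= p1 mul1r subrr.
rewrite psumr_eq0 => [/allP/(_ a (mem_index_enum _))|b Yb]; last first.
  by rewrite mulr_ge0 ?p0 // subr_ge0 NEp //; exact: Delta_vertex.
by rewrite Ya mulf_eq0 (negPf pa) subr_eq0 => /eqP.
Qed.

(* The sum is the derivative of [U] at [p] in the direction [d]. *)
Lemma NE_critical p (d : profile R n A) : NE Y u p ->
  (forall i, \sum_(a in Y i) d i a = 0) ->
  (forall i a, p i a = 0 -> d i a = 0) ->
  \sum_i U Y u (repl p i (d i)) = 0.
Proof.
move=> NEp d0 dp; apply: big1 => i _; rewrite U_repl_vertex.
rewrite (eq_bigr (fun a => d i a * U Y u p)) -?big_distrl /= ?d0 ?mul0r // => a Ya.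
have [/dp ->|pa] := eqVneq (p i a) 0; first by rewrite !mul0r.
by rewrite (NE_complementarity NEp).
Qed.

End GameUtility.

(** * Germs of real functions along an ultrafilter *)

Section Ultra.
Variables (R : realType) (F : set_system R).
Context {FU : UltraFilter F}.

(** As [F] is an ultrafilter, the null germs form a maximal ideal, whose residue field is an
    ultrapower of [R]. *)
Definition null_germ (b : R -> R) : Prop := F [set c | b c = 0].

Lemma null_germN b : ~ null_germ b -> F [set c | b c != 0].
Proof.
move=> nb; have [//|] := in_ultra_setVsetC [set c | b c = 0] FU.
by apply: filterS => c /eqP.
Qed.

Definition const_germ (r : R) : R -> R := fun=> r.

Fact const_germ_zmod_morphism : zmod_morphism const_germ.
Proof. by []. Qed.
Fact const_germ_monoid_morphism : monoid_morphism const_germ.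
Proof. by []. Qed.
HB.instance Definition _ :=
  GRing.isZmodMorphism.Build R (R -> R) const_germ const_germ_zmod_morphism.
HB.instance Definition _ :=
  GRing.isMonoidMorphism.Build R (R -> R) const_germ const_germ_monoid_morphism.

Lemma horner_const_germ (P : {poly R}) c : (map_poly const_germ P).[id] c = P.[c].
Proof.
elim/poly_ind: P => [|P a IH]; first by rewrite rmorph0 !horner0.
rewrite rmorphD rmorphM /= map_polyX map_polyC !hornerMXaddC -IH //.
Qed.

(** If [P] were nonzero, its roots would form a set of [F]; since [F] avoids any finite set, fresh
    roots could be picked until there are [size P] of them, one more than the degree. *)
Lemma id_germ_transcendental (P : {poly R}) : (forall r, F [set c | c != r]) ->
  null_germ (map_poly const_germ P).[id] -> P = 0.
Proof.
move=> Fneq FP; apply/eqP; apply: contraT => P0.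
have FP' : F [set c | root P c].
  by apply: filterS FP => c /=; rewrite horner_const_germ => /eqP.
have [rs [/eqP srs urs Prs]] :
    exists rs, [/\ size rs == size P, uniq rs & all (root P) rs].
  elim: (size P) => [|k [rs [/eqP srs urs Prs]]]; first by exists [::].
  have Frs : F [set c | c \notin rs].
    elim: (rs) => [|r s IH]; first exact: filterS filterT.
    apply: filterS (filterI (Fneq r) IH) => c [/= cr cs].
    by rewrite inE negb_or cr.
  have [c [/= Pc crs]] := filter_ex (filterI FP' Frs).
  by exists (c :: rs); split=> /=; rewrite ?srs ?crs ?Pc.
by have := max_poly_roots P0 Prs urs; rewrite srs ltnn.
Qed.

End Ultra.

Lemma NE_values_empty_interior (R : realType) (n : nat) (A : finType)
    (Y : 'I_n -> {set A}) (u : {ffun 'I_n -> A} -> R) (c1 c2 : R) : c1 < c2 ->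
  exists c, [/\ c1 < c, c < c2 & forall p, NE Y u p -> U Y u p <> c].
Proof.
move=> c12; apply: contrapT => nex.
have [p pNE] : exists p : R -> profile R n A,
    forall c, c1 < c -> c < c2 -> NE Y u (p c) /\ U Y u (p c) = c.
  have /choice[p pP] : forall c, exists p, c1 < c -> c < c2 -> NE Y u p /\ U Y u p = c.
    move=> c; have [c1c|c1c] := ltP c1 c; last by exists (fun _ _ => 0).
    have [cc2|cc2] := ltP c c2; last by exists (fun _ _ => 0).
    apply: contrapT => np; apply: nex; exists c; split=> // p pNE pc.
    by apply: np; exists p.
  by exists p.
(* This ultrafilter contains the open interval from [c1] to [c2] and charges no point, which makes
   the germ of the identity transcendental. *)
have [F [FU cF]] := ultraFilterLemma (at_right_proper_filter c1).
have Fp : F [set c | NE Y u (p c) /\ U Y u (p c) = c].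
  by apply: cF; near=> c; apply: pNE; near: c;
    [exact: nbhs_right_gt|exact: nbhs_right_lt].
have Fneq r : F [set c | c != r].
  apply: cF; have [rc|cr] := leP r c1; near=> c.
    by rewrite /= gt_eqF // (le_lt_trans rc) //; near: c; exact: nbhs_right_gt.
  by rewrite /= lt_eqF //; near: c; exact: nbhs_right_lt.
pose N := @null_germ R F.
have ND a b : N a -> N b -> N (a + b).
  by move=> Na Nb; apply: filterS (filterI Na Nb) => c [/= ac bc];
    rewrite -[_ c]/(a c + b c) ac bc addr0.
have NM a b : N b -> N (a * b).
  by apply: filterS => c /= bc; rewrite -[_ c]/(a c * b c) bc mulr0.
have Nprime a b : N (a * b) -> N a \/ N b.
  move=> Nab; apply: contrapT => /not_orP[/null_germN Na /null_germN Nb].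
  have [c [[/= ac bc]]] := filter_ex (filterI (filterI Na Nb) Nab).
  by move=> /eqP; rewrite -[_ c]/(a c * b c) mulf_eq0 (negPf ac) (negPf bc).
have Ninv a : ~ N a -> exists b, N (a * b - 1).
  move=> /null_germN Na; exists (fun c => (a c)^-1).
  by apply: filterS Na => c /= ac; rewrite -[LHS]/(a c / a c - 1) divff ?subrr.
have Nchar0 a k : N (a *+ k.+1) -> N a.
  apply: filterS => c /= /eqP.
  have -> : (a *+ k.+1) c = a c *+ k.+1 by elim: k => // k IH; rewrite !(mulrS _ k.+1) -IH.
  by rewrite mulrn_eq0 => /eqP.
have N0 : N 0 by apply: filterS filterT.
have transc (P : {poly R}) : N (map_poly (@const_germ R) P).[id] -> P = 0.
  exact: id_germ_transcendental.
pose x (ia : 'I_n * A) : R -> R := fun c => p c ia.1 ia.2.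
have [K [phi [Nphi phik [fc phic] phix]]] := exists_derivation ND NM Nprime
  Ninv Nchar0 N0 (codom x) transc.
have /choice[f /choice[d fd]] : forall ia, exists f d, phi f = (x ia, d).
  by move=> ia; apply: phix; exact: codom_f.
have /choice[w phiw] : forall y, exists f, phi f = (const_germ (u y), 0).
  by move=> y; exact: phik.
(* Either the coordinate is a null germ, and then so is its derivative, or it is nonzero on a set of
   [F], where the implication is void. *)
have Fd ia : F [set c | x ia c = 0 -> d ia c = 0].
  have [xia|/null_germN] := pselect (N (x ia)).
    by have := Nphi (f ia); rewrite fd => /(_ xia); apply: filterS => c /= ->.
  by apply: filterS => c /= /eqP.
have Fsum i : F [set c | \sum_(a in Y i) d (i, a) c = 0].
  have := Nphi (\sum_(a in Y i) f (i, a) - 1).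
  rewrite rmorphB rmorph1 rmorph_sum /= (eq_bigr _ (fun a _ => fd (i, a))).
  rewrite dual_sum1 dual_sum2 subr0 /=.
  move=> Nsum; have /Nsum : N (\sum_(a in Y i) x (i, a) - 1).
    apply: filterS Fp => c [[/= + _] _] => /(_ i)[p1 _ _].
    by rewrite -[LHS]/((\sum_(a in Y i) x (i, a)) c - 1) fct_sumE p1 subrr.
  by apply: filterS => c; rewrite /= fct_sumE.
(* [e] represents [U (p c) - c], a null germ; hence its derivative, that of [U] minus [1], is null
   too. *)
pose e := \sum_(y in joint_actions Y) w y * \prod_i f (i, y i) - fc.
have phie : phi e = \sum_(y in joint_actions Y) ((const_germ (u y), 0) : dual (R -> R)) *
    \prod_i ((x (i, y i), d (i, y i)) : dual (R -> R)) - (id, 1).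
  rewrite rmorphB rmorph_sum phic; congr (_ - _); apply: eq_bigr => y _.
  by rewrite rmorphM phiw rmorph_prod; congr (_ * _); apply: eq_bigr => i _.
have Fe : N (phi e).2.
  apply: Nphi; apply: filterS Fp => c [_ Uc] /=.
  rewrite phie dualD1 dual_sum1 -[LHS]/(_ c - c) fct_sumE -{2}Uc.
  apply/eqP; rewrite subr_eq0; apply/eqP; apply: eq_bigr => y _.
  by rewrite dualM1 dual_prod1 -[LHS]/(u y * _ c) fct_prodE.
(* There are finitely many conditions, so they hold together at some real [c]; there the derivative
   of [U] is [0] by [NE_critical] and [1] by [ec]. *)
have [c [[[[NEp _] dp] dsum] ec]] := filter_ex (filterI (filterI (filterI Fp
  (filter_forall _ Fd)) (filter_forall _ Fsum)) Fe).
have := NE_critical (d := fun i a => d (i, a) c) NEp dsum (fun i a => dp (i, a)).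
under eq_bigr do rewrite U_repl.
rewrite exchange_big /=; move: ec => /=.
rewrite phie dualD2 dual_sum2 -[LHS]/(_ c - 1) fct_sumE.
rewrite (eq_bigr (fun y => \sum_i u y * (d (i, y i) c *
    \prod_(j | j != i) p c j (y j)))) => [/eqP + S0|y _].
  by rewrite S0 sub0r oppr_eq0 oner_eq0.
rewrite dualM2 mul0r addr0 -[LHS]/(u y * _ c) big_dual2 ?index_enum_uniq //.
rewrite fct_sumE -big_distrr /=; congr (_ * _); apply: eq_bigr => i _.
by rewrite -[LHS]/(d (i, y i) c * _ c) fct_prodE.
Unshelve. all: by end_near. Qed.

(** * Regularity of the utility and of the gap *)

Section ProductEstimates.
Variables (R : realType) (I : eqType).
Implicit Types (r : seq I) (x y b : I -> R).

Lemma ler_norm_unit (z : R) : 0 <= z <= 1 -> `|z| <= 1.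
Proof. by case/andP => z0 z1; rewrite ger0_norm. Qed.

Lemma prod_lipschitz r x y :
  (forall i, 0 <= x i <= 1) -> (forall i, 0 <= y i <= 1) ->
  `|\prod_(i <- r) x i - \prod_(i <- r) y i| <= \sum_(i <- r) `|x i - y i|.
Proof.
move=> x01 y01; elim: r => [|i r IH]; first by rewrite !big_nil subrr normr0.
rewrite !big_cons.
set p := \prod_(j <- r) x j; set q := \prod_(j <- r) y j.
have -> : x i * p - y i * q = (x i - y i) * p + y i * (p - q) by ring.
rewrite (le_trans (ler_normD _ _)) // !normrM lerD //.
  rewrite ler_piMr // ler_norm_unit // prodr_ge0 /= => [|j _].
    by apply: prodr_ile1 => j _; exact: x01.
  by case/andP: (x01 j).
by rewrite (le_trans _ IH) // ler_piMl // ler_norm_unit.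
Qed.

(** A new factor multiplies the previous error by at most [1] and adds a cross term of size at most
    [k * g ^ 2]; the bound follows from [k ^ 2 + k <= (k + 1) ^ 2]. *)
Lemma prod_taylor2 r (g : R) x b : uniq r -> 0 <= g <= 1 ->
  (forall i, 0 <= x i <= 1) -> (forall i, 0 <= b i <= 1) ->
  `|\prod_(i <- r) (x i + g * (b i - x i)) - \prod_(i <- r) x i
    - g * \sum_(i <- r) (b i - x i) * \prod_(j <- r | j != i) x j|
  <= (size r)%:R ^+ 2 * g ^+ 2.
Proof.
move=> + g01 x01 b01; have /andP[g0 g1] := g01.
have h1 i : `|b i - x i| <= 1.
  have /andP[? ?] := x01 i; have /andP[? ?] := b01 i.
  by rewrite ler_norml; apply/andP; split; lra.
have x'01 i : 0 <= x i + g * (b i - x i) <= 1.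
  have /andP[? ?] := x01 i; have /andP[? ?] := b01 i.
  by apply/andP; split; nra.
elim: r => [_|i r IH /= /andP[ir /IH {}IH]].
  by rewrite !big_nil subrr mulr0 subr0 normr0 expr0n mul0r.
rewrite !big_cons eqxx /=.
have -> : \prod_(j <- r | j != i) x j = \prod_(j <- r) x j.
  rewrite big_seq_cond [RHS]big_seq; apply: eq_bigl => j.
  by rewrite andbC; case: eqVneq => // ->; rewrite (negPf ir).
have -> : \sum_(j <- r) (b j - x j) * \prod_(l <- i :: r | l != j) x l =
    x i * \sum_(j <- r) (b j - x j) * \prod_(l <- r | l != j) x l.
  rewrite big_distrr /= !big_seq; apply: eq_bigr => j jr.
  by rewrite big_cons ifT; [rewrite mulrCA|apply: contraNneq ir => ->].
set P' := \prod_(j <- r) _ in IH *; set P := \prod_(j <- r) _ in IH *.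
set S := \sum_(j <- r) _ in IH *; set k := (size r)%:R in IH *.
have P'P : `|P' - P| <= k * g.
  rewrite (le_trans (prod_lipschitz _ x'01 x01)) //.
  rewrite /k -sum1_size natr_sum big_distrl /= ler_sum // => j _.
  by rewrite addrC addKr normrM ger0_norm // mul1r ler_piMr.
have -> : (x i + g * (b i - x i)) * P' - x i * P -
  g * ((b i - x i) * P + x i * S) =
  x i * (P' - P - g * S) + g * (b i - x i) * (P' - P) by ring.
have k0 : 0 <= k by rewrite ler0n.
have E1 : `|x i * (P' - P - g * S)| <= k ^+ 2 * g ^+ 2.
  by rewrite normrM (le_trans _ IH) // ler_piMl // ler_norm_unit.
have E2 : `|g * (b i - x i) * (P' - P)| <= g * (k * g).
  rewrite normrM ler_pM // normrM ger0_norm // ler_piMr //.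
rewrite (le_trans (ler_normD _ _)) // (le_trans (lerD E1 E2)) //.
by rewrite -natr1; nra.
Qed.

End ProductEstimates.

Section Game.
Variables (R : realType) (n : nat) (A : finType).
Variables (Y : 'I_n -> {set A}) (u : {ffun 'I_n -> A} -> R).
Implicit Types p q b : profile R n A.

Definition l1dist p q : R := \sum_i \sum_(a : A) `|p i a - q i a|.

Definition unit_box p := forall i a, 0 <= p i a <= 1.

Definition step (g : R) p b : profile R n A :=
  fun i a => p i a + g * (b i a - p i a).

Definition Umass : R := \sum_(y in joint_actions Y) `|u y|.

Lemma l1dist_ge0 p q : 0 <= l1dist p q.
Proof. by do 2!apply: sumr_ge0 => ? _. Qed.

Lemma Umass_ge0 : 0 <= Umass.
Proof. exact: sumr_ge0. Qed.

Lemma DeltaN_box p : DeltaN Y p -> unit_box p.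
Proof.
move=> Dp i a; have [p1 p0 pz] := Dp i.
have [Ya|/pz ->] := boolP (a \in Y i); last by rewrite lexx ler01.
rewrite p0 //= -p1 (bigD1 a) //= lerDl sumr_ge0 // => c /andP[Yc _].
exact: p0.
Qed.

Lemma U_lipschitz p q : unit_box p -> unit_box q ->
  `|U Y u p - U Y u q| <= Umass * l1dist p q.
Proof.
move=> bp bq; rewrite /U -sumrB /Umass big_distrl /=.
rewrite (le_trans (ler_norm_sum _ _ _)) // ler_sum // => y _.
rewrite -mulrBr normrM ler_wpM2l // (le_trans (prod_lipschitz _ _ _)) //.
by rewrite ler_sum // => i _; rewrite (bigD1 (y i)) //= lerDl sumr_ge0.
Qed.

(** By multilinearity the derivative of [U] along [b - p] is the sum of the unilateral gains. *)
Lemma U_taylor2 p b g : unit_box p -> unit_box b -> 0 <= g <= 1 ->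
  `|U Y u (step g p b) - U Y u p
    - g * \sum_i (U Y u (repl p i (b i)) - U Y u p)|
  <= Umass * n%:R ^+ 2 * g ^+ 2.
Proof.
move=> bp bb g01.
have -> : \sum_i (U Y u (repl p i (b i)) - U Y u p) =
  \sum_(y in joint_actions Y) u y *
    \sum_i (b i (y i) - p i (y i)) * \prod_(j | j != i) p j (y j).
  under [RHS]eq_bigr do rewrite big_distrr.
  rewrite [RHS]exchange_big /=; apply: eq_bigr => i _.
  rewrite -(U_repl_id _ _ p i) !U_repl -sumrB; apply: eq_bigr => y _; ring.
rewrite big_distrr /= /U -!sumrB /Umass !big_distrl /=.
rewrite (le_trans (ler_norm_sum _ _ _)) // ler_sum // => y _.
rewrite mulrCA -!mulrBr normrM -mulrA ler_wpM2l //.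
have := @prod_taylor2 _ _ (index_enum 'I_n) g (fun i => p i (y i))
  (fun i => b i (y i)) (index_enum_uniq _) g01 (fun i => bp i _) (fun i => bb i _).
by rewrite -sum1_size sum1_card card_ord.
Qed.

Lemma repl_DeltaN p i x : DeltaN Y p -> Delta Y i x -> DeltaN Y (repl p i x).
Proof.
by move=> Dp Dx j; have [->|ji] := eqVneq j i; rewrite ?repl_at ?repl_out.
Qed.

Lemma l1dist_repl p q i x : l1dist (repl p i x) (repl q i x) <= l1dist p q.
Proof.
apply: ler_sum => j _; apply: ler_sum => a _.
have [->|ji] := eqVneq j i; last by rewrite !repl_out.
by rewrite !repl_at subrr normr0.
Qed.

Definition best p i : R := sup [set U Y u (repl p i x) | x in Delta Y i].

(** This makes [sup] a genuine least upper bound. The double sum of ones bounds the [l1dist]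
    diameter of the unit box. *)
Lemma best_has_sup p i : DeltaN Y p ->
  has_sup [set U Y u (repl p i x) | x in Delta Y i].
Proof.
move=> Dp; split; first by exists (U Y u (repl p i (p i))), (p i).
exists (U Y u p + Umass * \sum_(j < n) \sum_(a : A) 1) => _ [x Dx <-].
have bp := DeltaN_box Dp; have br := DeltaN_box (repl_DeltaN Dp Dx).
rewrite -lerBlDl (le_trans (ler_norm _)) // (le_trans (U_lipschitz br bp)) //.
rewrite ler_wpM2l ?Umass_ge0 //.
apply: ler_sum => j _; apply: ler_sum => a _.
by have /andP[? ?] := bp j a; have /andP[? ?] := br j a;
  rewrite ler_norml; apply/andP; split; lra.
Qed.

Lemma best_ge p i x : DeltaN Y p -> Delta Y i x -> U Y u (repl p i x) <= best p i.
Proof.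
by move=> Dp Dx; apply: ub_le_sup; [have [] := best_has_sup i Dp|exists x].
Qed.

Lemma best_ge_id p i : DeltaN Y p -> U Y u p <= best p i.
Proof. by move=> Dp; rewrite -(U_repl_id _ _ _ i); exact: best_ge. Qed.

Lemma best_lipschitz p q i : DeltaN Y p -> DeltaN Y q ->
  best p i <= best q i + Umass * l1dist p q.
Proof.
move=> Dp Dq; apply: ge_sup; first by have [] := best_has_sup i Dp.
move=> _ [x Dx <-]; have := best_ge Dq Dx.
have := U_lipschitz (DeltaN_box (repl_DeltaN Dp Dx)) (DeltaN_box (repl_DeltaN Dq Dx)).
move=> /(le_trans (ler_norm _)).
have := ler_wpM2l Umass_ge0 (l1dist_repl p q i x).
lra.
Qed.

Definition gap p : R := \sum_i (best p i - U Y u p).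

Lemma gap_ge0 p : DeltaN Y p -> 0 <= gap p.
Proof. by move=> Dp; apply: sumr_ge0 => i _; rewrite subr_ge0 best_ge_id. Qed.

Lemma l1distC p q : l1dist p q = l1dist q p.
Proof. by apply: eq_bigr => i _; apply: eq_bigr => a _; rewrite distrC. Qed.

Lemma gap_lipschitz p q : DeltaN Y p -> DeltaN Y q ->
  `|gap p - gap q| <= n%:R * (2 * Umass) * l1dist p q.
Proof.
move=> Dp Dq; rewrite /gap -sumrB (le_trans (ler_norm_sum _ _ _)) //.
apply: (@le_trans _ _ (\sum_(i < n) (2 * Umass * l1dist p q))); last first.
  by rewrite sumr_const card_ord -[leRHS]mulrA [leRHS]mulr_natl.
apply: ler_sum => i _.
have := U_lipschitz (DeltaN_box Dp) (DeltaN_box Dq).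
have := best_lipschitz i Dp Dq; have := best_lipschitz i Dq Dp.
rewrite (l1distC q p) !ler_norml => ? ? /andP[? ?].
by apply/andP; split; lra.
Qed.

Lemma gap0_NE p : DeltaN Y p -> gap p = 0 -> NE Y u p.
Proof.
move=> Dp /eqP; rewrite psumr_eq0 => [/allP g0|i _]; last first.
  by rewrite subr_ge0 best_ge_id.
split=> // i x Dx; have := g0 i (mem_index_enum _).
by rewrite subr_eq0 => /eqP <-; exact: best_ge.
Qed.

End Game.

(** * Centroids and compactness *)

Section Centroid.
Variables (R : realType) (n : nat) (A : finType).
Variables (Y : 'I_n -> {set A}) (u : {ffun 'I_n -> A} -> R).
Variable C : {set {set 'I_n}}.
Hypothesis hC : perm_invariant_partition Y u C.
Implicit Types p q a : profile R n A.

Local Notation blk := (finset.pblock C).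
Local Notation cen := (centroid C).

Let blk_mem i : i \in blk i.
Proof. by rewrite mem_pblock (cover_partition (let: And3 h _ _ := hC in h)) inE. Qed.

Let blk_in i : blk i \in C.
Proof. by rewrite pblock_mem // (cover_partition (let: And3 h _ _ := hC in h)) inE. Qed.

Let blk_def B i : B \in C -> i \in B -> blk i = B.
Proof.
case: hC => /and3P[_ tC _] _ _ BC iB; exact: def_pblock.
Qed.

Let blk_eq i j : j \in blk i -> blk j = blk i.
Proof. exact: blk_def. Qed.

Let blk_sym i j : (j \in blk i) = (i \in blk j).
Proof. by apply/idP/idP => /blk_eq E; rewrite -?E ?E. Qed.

Let card_blk i : (#|blk i|%:R : R) != 0.
Proof. by rewrite pnatr_eq0 -lt0n; apply/card_gt0P; exists i. Qed.

Lemma centroid_block_const p B i j : B \in C -> i \in B -> j \in B -> cen p i = cen p j.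
Proof. by move=> BC iB jB; rewrite /centroid (blk_def BC iB) (blk_def BC jB). Qed.

(** Each [h j] is counted once per member of the block of [j], with the inverse of the block size as
    weight. *)
Lemma sum_block_average (h : 'I_n -> R) :
  \sum_i #|blk i|%:R^-1 * \sum_(j in blk i) h j = \sum_i h i.
Proof.
under eq_bigr do rewrite big_distrr /= big_mkcond.
rewrite exchange_big /=; apply: eq_bigr => j _.
rewrite -big_mkcond /=.
rewrite (eq_bigr (fun=> #|blk j|%:R^-1 * h j)) => [|i ji]; last by rewrite (blk_eq ji).
rewrite (eq_bigl (mem (blk j))) => [|i]; last by rewrite blk_sym.
by rewrite sumr_const -[LHS]mulr_natl mulrA divff ?mul1r.
Qed.

Lemma centroid_DeltaN p : DeltaN Y p -> DeltaN Y (cen p).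
Proof.
case: hC => _ hY _ Dp i; have Yij j : j \in blk i -> Y j = Y i.
  by move=> ji; exact: hY (blk_in i) ji (blk_mem i).
split=> [|a Ya|a Ya]; rewrite /centroid /block_mean.
- rewrite -big_distrr exchange_big /= (eq_bigr (fun=> 1)) => [|j /Yij <-].
    by rewrite sumr_const mulVf.
  by have [] := Dp j.
- rewrite mulr_ge0 ?invr_ge0 // sumr_ge0 // => j /Yij E.
  by have [_ + _] := Dp j; apply; rewrite E.
- rewrite big1 ?mulr0 // => j /Yij E.
  by have [_ _] := Dp j; apply; rewrite E.
Qed.

Lemma l1dist_centroid p q : l1dist (cen p) (cen q) <= l1dist p q.
Proof.
rewrite -[leRHS]sum_block_average; apply: ler_sum => i _.
rewrite exchange_big big_distrr /=; apply: ler_sum => a _.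
rewrite /centroid /block_mean -mulrBr -sumrB normrM ger0_norm ?invr_ge0 //.
by rewrite ler_wpM2l ?invr_ge0 // ler_norm_sum.
Qed.

Lemma centroid_step g p a : cen (step g p a) = step g (cen p) (cen a).
Proof.
apply/funext => i; apply/funext => b.
rewrite /centroid /block_mean /step big_split -big_distrr sumrB /=; ring.
Qed.

(** Interchanging the actions of [i] and [j] in the sum moves [x] from one player to the other, and
    [p i = p j] makes the remaining factors match. *)
Lemma U_repl_block p x B i j : B \in C -> i \in B -> j \in B -> p i = p j ->
  U Y u (repl p i x) = U Y u (repl p j x).
Proof.
case: hC => _ hY hu BC iB jB pij.
have YB := hY _ _ _ BC iB jB.
have swapK : involutive (swap_actions i j : {ffun 'I_n -> A} -> _).
  by move=> y; apply/ffunP => l; rewrite !ffunE tpermK.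
rewrite [RHS]/U (reindex_inj (inv_inj swapK)) /=.
apply: eq_big => [y|y Yy].
  rewrite !inE; apply/forallP/forallP => h l.
    rewrite ffunE; case: tpermP => [->|->|_ _]; last exact: h.
      by rewrite YB.
    by rewrite -YB.
  have := h (tperm i j l); rewrite ffunE tpermK.
  by case: tpermP => [->|->|_ _] //; rewrite YB.
rewrite (hu B) //; congr (_ * _); rewrite (reindex_inj (@perm_inj _ (tperm i j))) /=.
apply: eq_bigr => l _; rewrite ffunE; congr (_ _).
have [->|ij] := eqVneq j i; first by rewrite tperm1 perm1.
case: tpermP => [->|->|/eqP li /eqP lj].
- by rewrite !repl_out // eq_sym.
- by rewrite !repl_at.
- by rewrite !repl_out.
Qed.

Lemma U_repl_mean p (h : profile R n A) i (B : {set 'I_n}) :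
  U Y u (repl p i (block_mean h B)) =
  #|B|%:R^-1 * \sum_(j in B) U Y u (repl p i (h j)).
Proof.
rewrite U_repl_vertex; under [in RHS]eq_bigr do rewrite U_repl_vertex.
rewrite exchange_big big_distrr /=; apply: eq_bigr => b _.
by rewrite -big_distrl /= mulrA.
Qed.

(** By linearity the mean response of a block yields the average over its members [j] of the payoff
    of [a j] played by [i]; the centroid being constant on the block, [a j] may as well be played by
    [j]. *)
Lemma sum_U_repl_centroid p a :
  \sum_i U Y u (repl (cen p) i (cen a i)) = \sum_i U Y u (repl (cen p) i (a i)).
Proof.
rewrite -[RHS]sum_block_average; apply: eq_bigr => i _.
rewrite U_repl_mean; congr (_ * _); apply: eq_bigr => j ji.
by apply: (@U_repl_block _ _ (blk i)) => //; apply: (@centroid_block_const _ (blk i)).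
Qed.

Lemma gap0_SNE p : DeltaN Y p -> gap Y u (cen p) = 0 -> SNE Y u C (cen p).
Proof.
move=> Dp g0; split; first exact/gap0_NE/g0/centroid_DeltaN.
exact: centroid_block_const.
Qed.

(* Averaging over blocks, the deviation losses of [p] against its centroid add
   up to the gap of the centroid. *)
Lemma gap0_MCE p : DeltaN Y p -> gap Y u (cen p) = 0 -> MCE Y u C p.
Proof.
move=> Dp; have Dc := centroid_DeltaN Dp.
have -> : gap Y u (cen p) =
    \sum_i (best Y u (cen p) i - U Y u (repl (cen p) i (p i))).
  rewrite /gap !sumrB -sum_U_repl_centroid; congr (_ - _).
  by apply: eq_bigr => i _; rewrite U_repl_id.
move=> /eqP; rewrite psumr_eq0 => [/allP g0|i _]; last first.
  by rewrite subr_ge0 best_ge //; exact: Dp.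
split=> // i x Dx; have := g0 i (mem_index_enum _).
by rewrite subr_eq0 => /eqP <-; exact: best_ge.
Qed.

(** The term in [e] is the total best-response error of the [n] players, the other one the
    second-order remainder. *)
Lemma ECFP_ascent p a (g e : R) : DeltaN Y p -> DeltaN Y a -> 0 <= g <= 1 ->
  BR Y u e (cen p) a ->
  g * (gap Y u (cen p) - (n%:R * e + Umass Y u * n%:R ^+ 2 * g)) <=
  U Y u (cen (step g p a)) - U Y u (cen p).
Proof.
move=> Dp Da g01 BRa; have /andP[g0 _] := g01.
have := U_taylor2 Y u (DeltaN_box (centroid_DeltaN Dp))
  (DeltaN_box (centroid_DeltaN Da)) g01.
have -> : \sum_i (U Y u (repl (cen p) i (cen a i)) - U Y u (cen p)) =
    \sum_i (U Y u (repl (cen p) i (a i)) - U Y u (cen p)).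
  by rewrite !big_split /= sum_U_repl_centroid.
rewrite -centroid_step ler_norml => /andP[lo _].
have : gap Y u (cen p) - n%:R * e <=
    \sum_i (U Y u (repl (cen p) i (a i)) - U Y u (cen p)).
  have -> : n%:R * e = \sum_(i < n) e by rewrite sumr_const card_ord mulr_natl.
  rewrite /gap -sumrB; apply: ler_sum => i _.
  have [_ BRai] := BRa i.
  have {}BRai : best Y u (cen p) i - e <= U Y u (repl (cen p) i (a i)) := BRai.
  lra.
move=> /(ler_wpM2l g0); lra.
Qed.

Lemma l1dist_step g p a : DeltaN Y p -> DeltaN Y a -> 0 <= g ->
  l1dist (step g p a) p <= (\sum_(i < n) \sum_(b : A) 1) * g.
Proof.
move=> Dp Da g0; rewrite big_distrl; apply: ler_sum => i _.
rewrite big_distrl; apply: ler_sum => b _ /=.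
rewrite addrC addKr normrM ger0_norm // mulrC ler_wpM2r //.
have /andP[? ?] := DeltaN_box Dp i b; have /andP[? ?] := DeltaN_box Da i b.
by rewrite ler_norml; apply/andP; split; lra.
Qed.

End Centroid.

Lemma cvg_finite_sum (R : realType) (T I : Type) (G : set_system T)
    (FG : Filter G) (r : seq I) (P : pred I) (f : I -> T -> R) (l : I -> R) :
  (forall i, P i -> f i @ G --> l i) ->
  (fun t => \sum_(i <- r | P i) f i t) @ G --> \sum_(i <- r | P i) l i.
Proof.
move=> fl; rewrite -fct_sumE; elim/big_rec2: _ => [|i y g Pi gy].
  exact: cvg_cst.
by apply: cvgD => //; exact: fl.
Qed.

Section Compactness.
Variables (R : realType) (n : nat) (A : finType) (Y : 'I_n -> {set A}).
Implicit Types p q : profile R n A.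

(** Along an ultrafilter finer than [F] every coordinate converges. The conclusion expresses that
    [l] is a cluster point directly in terms of [l1dist]. *)
Lemma DeltaN_compact (T : Type) (F : set_system T) (x : T -> profile R n A) :
  ProperFilter F -> (forall t, DeltaN Y (x t)) ->
  exists2 l, DeltaN Y l &
    forall (P : set T) e, F P -> 0 < e -> exists2 t, P t & l1dist (x t) l < e.
Proof.
move=> FF Dx; have [G [GU FG]] := ultraFilterLemma FF.
have /choice[l xl] : forall ia : 'I_n * A, exists l : R,
    (fun t => x t ia.1 ia.2) @ G --> l.
  move=> ia; pose f t := x t ia.1 ia.2.
  have f01 : (f @ G) `[0, 1]%classic.
    apply: (@filterE _ G) => t; rewrite /= in_itv.
    exact: (DeltaN_box (Dx t) ia.1 ia.2).
  have FPG : ProperFilter (f @ G) by exact: fmap_proper_filter.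
  have [c [_ cG]] := @segment_compact R 0 1 _ FPG f01.
  (* For an ultrafilter a cluster point is a limit: otherwise the complement of [V] would be large
     and would have to meet [V]. *)
  exists c; move=> V Vc.
  have [//|nV] := in_ultra_setVsetC (f @^-1` V) GU.
  by have [z [nVz /nVz]] := cG (~` V) V nV Vc.
pose L : profile R n A := fun i a => l (i, a).
have xL i a : (fun t => x t i a) @ G --> L i a by exact: (xl (i, a)).
exists L => [i|P e /FG GP e0].
  split=> [|a Ya|a Ya].
  - have : (fun t => \sum_(a in Y i) x t i a) @ G --> \sum_(a in Y i) L i a.
      by apply: cvg_finite_sum => a _; exact: xL.
    rewrite (_ : (fun t => _) = cst 1) => [/(cvg_unique _ (cvg_cst _))<- //|].
    by apply/funext => t; have [] := Dx t i.
  - rewrite leNgt; apply/negP => La.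
    have [t] := filter_ex (cvgr_lt (L i a) (xL i a) 0 La).
    by have [_ + _] := Dx t i => /(_ a Ya) x0; rewrite ltNge x0.
  - have := xL i a; rewrite (_ : (fun t => _) = cst 0) => [/(cvg_unique _ (cvg_cst _))<- //|].
    by apply/funext => t; have [_ _] := Dx t i; apply.
have : (fun t => l1dist (x t) L) @ G --> (\sum_(i < n) \sum_(a : A) `|L i a - L i a|).
  apply: cvg_finite_sum => i _; apply: cvg_finite_sum => a _.
  by apply: cvg_norm; apply: cvgB; [exact: xL|exact: cvg_cst].
rewrite (_ : \sum_(i < n) _ = 0); last first.
  by rewrite big1 // => i _; rewrite big1 // => a _; rewrite subrr normr0.
move=> /cvgr_lt/(_ _ e0) Ge.
by have [t [/= ? ?]] := filter_ex (filterI GP Ge); exists t.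
Qed.

End Compactness.

(** * The ascent argument *)

Lemma cvg0_eventually (R : realType) (f : nat -> R) (e : R) (T0 : nat) :
  f @ \oo --> 0 -> 0 < e -> exists2 T, (T0 <= T)%N & forall t, (T <= t)%N -> `|f t| < e.
Proof.
move=> /cvgr0Pnorm_lt/(_ e) + e0 => /(_ e0)[T _ fT].
exists (maxn T0 T); first exact: leq_maxl.
by move=> t; rewrite geq_max => /andP[_]; exact: fT.
Qed.

Section Lyapunov.
(** In the application [v] and [G] are the utility and the gap at the centroid, [g] the step sizes
    and [b] the vanishing error of the ascent. *)
Variables (R : realType) (v G g b : nat -> R) (K M : R) (T0 : nat).
Hypothesis g_ge0 : forall t, (T0 <= t)%N -> 0 <= g t.
Hypothesis ascent : forall t, (T0 <= t)%N -> g t * (G t - b t) <= v t.+1 - v t.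
Hypothesis v_step : forall t, (T0 <= t)%N -> `|v t.+1 - v t| <= K * g t.
Hypothesis G_step : forall t, (T0 <= t)%N -> `|G t.+1 - G t| <= K * g t.
Hypothesis v_bound : forall t, (T0 <= t)%N -> `|v t| <= M.
Hypothesis K_ge0 : 0 <= K.
Hypothesis g_cvg0 : g @ \oo --> 0.
Hypothesis b_cvg0 : b @ \oo --> 0.
Hypothesis g_dvg : forall s B, (T0 <= s)%N ->
  exists2 t, (s <= t)%N & B < \sum_(s <= j < t) g j.
Hypothesis regular_value : forall c1 c2, c1 < c2 -> exists c, [/\ c1 < c, c < c2 &
  exists eta delta, [/\ 0 < eta, 0 < delta &
    forall t, (T0 <= t)%N -> `|v t - c| <= eta -> delta <= G t]].

(** A regular value [c] is eventually a one-way barrier: in the band of height [eta] above [c] the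
    gap exceeds [b], so [v] does not decrease; above the band a single step loses less than
    [eta]. *)
Let v_dichotomy c1 c2 : c1 < c2 -> exists c T, [/\ c1 < c, c < c2, (T0 <= T)%N &
  (forall t, (T <= t)%N -> c <= v t) \/ (forall t, (T <= t)%N -> v t < c)].
Proof.
move=> /regular_value[c [c1c cc2 [eta [delta [eta0 delta0 Gd]]]]].
have [T1 T01 bT] := cvg0_eventually T0 b_cvg0 delta0.
have eK : 0 < eta / (K + 1) by rewrite divr_gt0 // ltr_wpDl.
have [T T1T gT] := cvg0_eventually T1 g_cvg0 eK.
have T0T : (T0 <= T)%N by exact: leq_trans T01 T1T.
have stay t : (T <= t)%N -> c <= v t -> c <= v t.+1.
  move=> Tt cv; have T0t := leq_trans T0T Tt.
  have [vc|vc] := leP (v t) (c + eta).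
    have dG : delta <= G t by apply: Gd => //; rewrite ger0_norm; lra.
    have := bT _ (leq_trans T1T Tt); have := ascent T0t; have := g_ge0 T0t.
    by rewrite ltr_norml => ? ? /andP[? ?]; nra.
  have := v_step T0t; rewrite ler_norml => /andP[lo _].
  have := gT _ Tt; rewrite ger0_norm ?g_ge0 // ltr_pdivlMr ?ltr_wpDl // => ge.
  by have := g_ge0 T0t; nra.
have [[t Tt cv]|nex] := pselect (exists2 t, (T <= t)%N & c <= v t).
  exists c, t; split=> //; first exact: leq_trans T0T Tt.
  left; elim=> [|s IH]; first by rewrite leqn0 => /eqP <-.
  rewrite leq_eqVlt => /predU1P[<- //|ts].
  by apply: stay; [exact: leq_trans Tt ts|exact: IH].
exists c, T; split=> //; right=> t Tt; rewrite ltNge; apply/negP => cv.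
by apply: nex; exists t.
Qed.

Let v_cvg : exists L, forall e, 0 < e ->
  exists2 T, (T0 <= T)%N & forall t, (T <= t)%N -> `|v t - L| <= e.
Proof.
(* [sup S] is the lower limit of [v]. A barrier just above it cannot bound [v] from below, as it
   would belong to [S]; so [v] ends up below it. *)
pose S := [set c | exists2 T, (T0 <= T)%N & forall t, (T <= t)%N -> c <= v t].
have ubS : ubound S M.
  move=> c [T T0T cv]; rewrite (le_trans (cv T _)) //.
  exact: le_trans (ler_norm _) (v_bound _).
have hS : has_sup S.
  split; last by exists M.
  exists (- M); exists T0 => // t /v_bound.
  by rewrite ler_norml => /andP[].
exists (sup S) => e e0.
have [c' [T' T0T' c'v] c'e] := sup_adherent e0 hS.
have Le : sup S < sup S + e by rewrite ltrDl.
have [c [T [Lc ce T0T [cv|vc]]]] := v_dichotomy Le.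
  have /(ub_le_sup (proj2 hS)) : S c by exists T.
  by rewrite leNgt Lc.
exists (maxn T' T); first by rewrite leq_max T0T'.
move=> t; rewrite geq_max => /andP[/c'v ? /vc ?].
by rewrite ler_norml; apply/andP; split; lra.
Qed.

(** Suppose [2 * d <= G s] at a late time [s]. While [G] stays at least [d], [v] grows in proportion
    to the accumulated steps; as [v] converges, these steps are too few for [G] to lose [d]. So [G]
    stays at least [d] forever, against the divergence of the steps. *)
Lemma lyapunov_gap_cvg0 e : 0 < e ->
  exists2 T, (T0 <= T)%N & forall t, (T <= t)%N -> G t < e.
Proof.
move=> e0; pose d := e / 2; have d0 : 0 < d by rewrite divr_gt0.
have K1 : 0 < K + 1 by rewrite ltr_wpDl.
(* Late values of [v] differ by at most [2 * k], so the steps add up to at most [4 * k / d], and [K]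
   times this is at most [d]. *)
pose k := d ^+ 2 / (4 * (K + 1)).
have k0 : 0 < k by rewrite divr_gt0 ?exprn_gt0 // mulr_gt0.
have kE : 4 * k * (K + 1) = d ^+ 2 by rewrite /k; field; rewrite gt_eqF.
have [L vL] := v_cvg; have [T1 T01 {}vL] := vL k k0.
have [T T1T bT] := cvg0_eventually T1 b_cvg0 (divr_gt0 d0 (ltr0n R 2)).
exists T; first exact: leq_trans T01 T1T.
move=> s Ts; rewrite ltNge; apply/negP => eG.
have T0_le j : (s <= j)%N -> (T0 <= j)%N.
  by move=> sj; rewrite (leq_trans T01) // (leq_trans T1T) // (leq_trans Ts).
have sum_bound t : (s <= t)%N -> (forall j, (s <= j < t)%N -> d <= G j) ->
    d * \sum_(s <= j < t) g j <= 4 * k.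
  move=> st dG.
  have : \sum_(s <= j < t) g j * (d / 2) <= v t - v s.
    rewrite -telescope_sumr // big_nat [leRHS]big_nat; apply: ler_sum => j sjt.
    have /andP[sj _] := sjt; have T0j := T0_le _ sj.
    have := bT _ (leq_trans Ts sj); have := dG _ sjt.
    have := ascent T0j; have := g_ge0 T0j.
    by rewrite ltr_norml => ? ? ? /andP[? ?]; nra.
  have := vL _ (leq_trans (leq_trans T1T Ts) st); have := vL _ (leq_trans T1T Ts).
  rewrite -big_distrl /= !ler_norml => /andP[? ?] /andP[? ?]; lra.
have dG t : (s <= t)%N -> d <= G t.
  elim/ltn_ind: t => t IH st.
  have {}IH j : (s <= j < t)%N -> d <= G j by move=> /andP[sj jt]; exact: IH.
  have := sum_bound _ st IH.
  have : G s - G t <= K * \sum_(s <= j < t) g j.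
    rewrite -opprB -telescope_sumr // -sumrN big_distrr /=.
    rewrite big_nat [leRHS]big_nat; apply: ler_sum => j /andP[sj _].
    by have := G_step (T0_le _ sj); rewrite ler_norml; lra.
  have : e = 2 * d by rewrite /d; field.
  set S := \sum_(s <= j < t) g j => ed GG dS.
  have : K * S <= d.
    have S0 : 0 <= S by rewrite /S big_nat sumr_ge0 // => j /andP[/T0_le/g_ge0].
    by rewrite -(ler_pM2l d0); nra.
  lra.
have [t st] := g_dvg (4 * k / d) (T0_le _ (leqnn s)).
rewrite ltr_pdivrMr // [_ * d]mulrC ltNge sum_bound // => j /andP[sj _]; exact: dG.
Qed.

End Lyapunov.

(** * Distances to sets and zeros at cluster points *)

Section Limits.
Variables (R : realType) (n : nat) (A : finType).
Implicit Types p q l : profile R n A.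

Lemma sum_sqr_le_sqr_sum I (r : seq I) (f : I -> R) : (forall i, 0 <= f i) ->
  \sum_(i <- r) f i ^+ 2 <= (\sum_(i <- r) f i) ^+ 2.
Proof.
move=> f0; elim: r => [|i r IH]; first by rewrite !big_nil expr0n.
rewrite !big_cons sqrrD -addrA lerD2l (le_trans IH) // lerDr.
by rewrite mulrn_wge0 // mulr_ge0 // sumr_ge0.
Qed.

Lemma l2dist_le_l1dist p q : l2dist p q <= l1dist p q.
Proof.
rewrite -[leRHS]ger0_norm ?l1dist_ge0 // -sqrtr_sqr ler_sqrt ?sqr_ge0 //.
apply: le_trans (sum_sqr_le_sqr_sum _ _) => [|i]; last exact: sumr_ge0.
apply: ler_sum => i _; apply: le_trans (sum_sqr_le_sqr_sum _ _) => // .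
by apply: ler_sum => a _; rewrite real_normK // num_real.
Qed.

Lemma dist_set_cvg0 (x : nat -> profile R n A) (S : set (profile R n A)) :
  (forall e, 0 < e -> exists T, forall t, (T <= t)%N ->
     exists2 s, S s & l1dist (x t) s < e) ->
  dist_set (x t) S @[t --> \oo] --> 0%E.
Proof.
move=> xS.
have d0 t : (0 <= dist_set (x t) S)%E.
  by apply: le_ereal_inf_tmp => _ [s _ <-]; rewrite lee_fin sqrtr_ge0.
have de e : 0 < e -> \forall t \near \oo, (dist_set (x t) S < e%:E)%E.
  move=> /xS[T dT]; exists T => // t /dT[s Ss xs].
  apply: (@le_lt_trans _ _ (l2dist (x t) s)%:E).
    by apply: ereal_inf_lbound; exists s.
  by rewrite lte_fin (le_lt_trans (l2dist_le_l1dist _ _)).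
apply/fine_cvgP; split.
  apply: filterS (de 1 ltr01) => t dt.
  by rewrite ge0_fin_numE // (lt_trans dt) // ltry.
apply/cvgr0Pnorm_lt => e /de; apply: filterS => t dt /=.
by rewrite ger0_norm ?fine_ge0 // -lte_fin fineK // ge0_fin_numE // (lt_trans dt) // ltry.
Qed.

Lemma cluster_zero (Y : 'I_n -> {set A}) (phi : profile R n A -> R) (K : R)
    (x : nat -> profile R n A) l :
  (forall p q, DeltaN Y p -> DeltaN Y q -> `|phi p - phi q| <= K * l1dist p q) ->
  0 <= K -> (forall k, DeltaN Y (x k)) -> DeltaN Y l ->
  (forall (P : set nat) e, \oo P -> 0 < e -> exists2 k, P k & l1dist (x k) l < e) ->
  (forall k, `|phi (x k)| < k.+1%:R^-1) -> phi l = 0.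
Proof.
move=> phiL K0 Dx Dl xl phix; apply/eqP; rewrite -normr_eq0; apply: contraT => nz.
have phi0 : 0 < `|phi l| by rewrite lt_neqAle eq_sym nz normr_ge0.
have K2 : 0 < K + 2 by rewrite ltr_wpDl.
(* With this radius [e], proximity to [l] and smallness of [phi (x k)] give a bound below
   [(K + 1) * e], whereas the norm of [phi l] is [(K + 2) * e]. *)
have e0 : 0 < `|phi l| / (K + 2) by rewrite divr_gt0.
have [k /= ke dk] := xl _ _ (near_infty_natSinv_lt (PosNum e0)) e0.
set e := `|phi l| / (K + 2) in e0 ke dk.
have {}ke : k.+1%:R^-1 < e := ke.
have eE : `|phi l| = e * (K + 2) by rewrite /e divfK // gt_eqF.
have tri : `|phi l| <= `|phi (x k) - phi l| + `|phi (x k)|.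
  by rewrite distrC -{1}(subrK (phi (x k)) (phi l)) ler_normD.
have h1 := ler_wpM2l K0 (ltW dk); have h2 := phiL _ _ (Dx k) Dl.
have h3 := lt_trans (phix k) ke.
have : `|phi l| < K * e + e.
  by rewrite (le_lt_trans tri) // ler_ltD // (le_trans h2).
by rewrite eE mulrDr [e * K]mulrC ltrD2l; lra.
Qed.

End Limits.

(** * Convergence of the process *)

Lemma series_tail_unbounded (R : realType) (g : nat -> R) :
  (forall t, (1 <= t)%N -> 0 <= g t) ->
  (\sum_(1 <= t <oo) (g t)%:E = +oo)%E ->
  forall s B, (1 <= s)%N -> exists2 t, (s <= t)%N & B < \sum_(s <= j < t) g j.
Proof.
move=> g0 gsum s B s1.
have : (fun t => \sum_(1 <= j < t) (g j)%:E)%E @ \oo --> +oo%E.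
  rewrite -gsum; apply: is_cvg_nneseries => t t1 _; rewrite lee_fin; exact: g0.
move=> /cvgey_gt/(_ (B + \sum_(1 <= j < s) g j))[T _ gT].
exists (maxn s T); first exact: leq_maxl.
have := gT (maxn s T) (leq_maxr _ _); rewrite /= sumEFin lte_fin.
by rewrite (@big_cat_nat _ _ _ s 1 (maxn s T)) ?leq_maxl //= [ltRHS]addrC ltrD2r.
Qed.

Theorem theorem1 (R : realType) (n : nat) (A : finType)
  (Y : 'I_n -> {set A}) (u : {ffun 'I_n -> A} -> R)
  (C : {set {set 'I_n}}) (hC : perm_invariant_partition Y u C)
  (gamma : nat -> R)
  (gamma_ge0 : forall t, (1 <= t)%N -> 0 <= gamma t)
  (gamma_sum : (\sum_(1 <= t <oo) (gamma t)%:E = +oo)%E)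
  (gamma_cvg : gamma t @[t --> \oo] --> (0 : R))
  (eps : nat -> R)
  (eps_ge0 : forall t, (1 <= t)%N -> 0 <= eps t)
  (eps_cvg : eps t @[t --> \oo] --> (0 : R))
  (q qbar : nat -> profile R n A)
  (hq : discrete_ECFP Y u C gamma eps q qbar) :
  (dist_set (q t) (MCE Y u C) @[t --> \oo] --> 0%E) /\
  (dist_set (qbar t) (SNE Y u C) @[t --> \oo] --> 0%E).
Proof.
case: hq => a [Dq _ qS qbarE BRa].
have Dqt t : (1 <= t)%N -> DeltaN Y (q t) by move=> /Dq[].
have Dat t : (1 <= t)%N -> DeltaN Y (a t) by move=> /Dq[].
have Dc t : (1 <= t)%N -> DeltaN Y (centroid C (q t)).
  by move=> /Dqt; exact: (centroid_DeltaN hC).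
have qstep t : (1 <= t)%N -> q t.+1 = step (gamma t) (q t) (a t.+1).
  by move=> t1; apply/funext => i; apply/funext => b; exact: qS.
pose G t := gap Y u (centroid C (q t)).
pose v t := U Y u (centroid C (q t)).
pose mass := Umass Y u.
pose width : R := \sum_(i < n) \sum_(b : A) 1.
have mass0 : 0 <= mass by exact: Umass_ge0.
have width0 : 0 <= width by rewrite /width; do 2!apply: sumr_ge0 => ? _.
have n0 : 0 <= n%:R :> R by [].
have capL p p' : DeltaN Y p -> DeltaN Y p' ->
    `|gap Y u (centroid C p) - gap Y u (centroid C p')| <= n%:R * (2 * mass) * l1dist p p'.
  move=> Dp Dp'.
  rewrite (le_trans (gap_lipschitz u (centroid_DeltaN hC Dp) (centroid_DeltaN hC Dp'))) //.
  by rewrite ler_wpM2l ?mulr_ge0 ?(l1dist_centroid hC).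
have UL p p' : DeltaN Y p -> DeltaN Y p' ->
    `|U Y u (centroid C p) - U Y u (centroid C p')| <= mass * l1dist p p'.
  move=> Dp Dp'.
  rewrite (le_trans (U_lipschitz Y u (DeltaN_box (centroid_DeltaN hC Dp))
    (DeltaN_box (centroid_DeltaN hC Dp')))) //.
  by rewrite ler_wpM2l ?(l1dist_centroid hC).
have nm0 : 0 <= n%:R * (2 * mass) by rewrite !mulr_ge0.
pose K := (mass + n%:R * (2 * mass)) * width.
have K0 : 0 <= K by rewrite mulr_ge0 // addr_ge0.
have move_le t : (1 <= t)%N -> l1dist (q t.+1) (q t) <= width * gamma t.
  by move=> t1; rewrite qstep //; apply: l1dist_step; auto.
have v_step t : (1 <= t)%N -> `|v t.+1 - v t| <= K * gamma t.
  move=> t1; apply: le_trans (UL _ _ (Dqt t.+1 isT) (Dqt t t1)) _.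
  rewrite (le_trans (ler_wpM2l mass0 (move_le t t1))) // [leLHS]mulrA ler_wpM2r ?gamma_ge0 //.
  by rewrite /K [leRHS]mulrDl lerDl mulr_ge0.
have G_step t : (1 <= t)%N -> `|G t.+1 - G t| <= K * gamma t.
  move=> t1; apply: le_trans (capL _ _ (Dqt t.+1 isT) (Dqt t t1)) _.
  rewrite (le_trans (ler_wpM2l nm0 (move_le t t1))) // [leLHS]mulrA ler_wpM2r ?gamma_ge0 //.
  by rewrite /K [leRHS]mulrDl lerDr mulr_ge0.
(* The Taylor estimate requires step sizes at most [1], which is guaranteed only from [T0] on. *)
have [T0 T01 gamma1] := cvg0_eventually 1 gamma_cvg ltr01.
have ge1 t : (T0 <= t)%N -> (1 <= t)%N by exact: leq_trans.
pose beta t := n%:R * eps t + mass * n%:R ^+ 2 * gamma t.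
have beta_cvg : beta @ \oo --> 0.
  have := cvgD (cvgM (cvg_cst (n%:R : R)) eps_cvg)
    (cvgM (cvg_cst (mass * n%:R ^+ 2)) gamma_cvg).
  by rewrite !mulr0 addr0; exact.
have ascent t : (T0 <= t)%N -> gamma t * (G t - beta t) <= v t.+1 - v t.
  move=> T0t; have t1 := ge1 t T0t; rewrite /v qstep //.
  apply: (ECFP_ascent hC) => //; [exact: Dqt|exact: Dat| |].
    rewrite gamma_ge0 //=; have := gamma1 t T0t.
    by rewrite ger0_norm ?gamma_ge0 // => /ltW.
  by rewrite -qbarE //; exact: BRa.
have v_bound t : (T0 <= t)%N -> `|v t| <= `|v 1%N| + mass * width.
  move=> /ge1 t1; rewrite -lerBlDl (le_trans (lerB_dist _ _)) //.
  apply: le_trans (UL _ _ (Dqt t t1) (Dqt 1%N isT)) _; rewrite ler_wpM2l //.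
  apply: ler_sum => i _; apply: ler_sum => b _.
  have /andP[? ?] := DeltaN_box (Dqt t t1) i b.
  have /andP[? ?] := DeltaN_box (Dqt 1%N isT) i b.
  by rewrite ler_norml; apply/andP; split; lra.
have regular c1 c2 : c1 < c2 -> exists c, [/\ c1 < c, c < c2 &
    exists eta delta, [/\ 0 < eta, 0 < delta &
      forall t, (T0 <= t)%N -> `|v t - c| <= eta -> delta <= G t]].
  move=> /(NE_values_empty_interior Y u)[c [c1c cc2 cNE]].
  (* If [c] were not regular, there would be times [s k], in no particular order, along which the
     gap tends to [0] and [v] to [c]; at a cluster point of [q (s k)] the centroid would be an
     equilibrium of value [c]. *)
  exists c; split=> //; apply: contrapT => nreg.
  have /choice[s sP] : forall k, exists t,
      [/\ (T0 <= t)%N, `|v t - c| < k.+1%:R^-1 & `|G t| < k.+1%:R^-1].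
    move=> k; apply: contrapT => nt; apply: nreg.
    (* Halving turns the large inequality on [v t - c] into a strict one. *)
    exists (k.+1%:R^-1 / 2), (k.+1%:R^-1); split; rewrite ?divr_gt0 ?invr_gt0 //.
    move=> t T0t vt; rewrite leNgt; apply/negP => Gt; apply: nt; exists t; split=> //.
      by rewrite (le_lt_trans vt) // ltr_pdivrMr // ltr_pMr ?invr_gt0 // ltr1n.
    by rewrite ger0_norm // gap_ge0 //; exact/Dc/ge1.
  have Dx k : DeltaN Y (q (s k)) by have [/ge1 /Dqt] := sP k.
  have [l Dl xl] := @DeltaN_compact _ _ _ _ _ \oo _ _ Dx.
  apply: (cNE (centroid C l)).
    apply: gap0_NE; first exact: (centroid_DeltaN hC).
    by apply: (cluster_zero capL nm0 Dx Dl xl) => k; have [] := sP k.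
  apply/eqP; rewrite -subr_eq0; apply/eqP.
  apply: (@cluster_zero _ _ _ Y (fun p => U Y u (centroid C p) - c) mass _ l _ mass0 Dx Dl xl).
    by move=> p p' Dp Dp'; rewrite opprB addrA subrK; exact: UL.
  by move=> k; have [] := sP k.
have G_cvg := lyapunov_gap_cvg0 (fun t Tt => gamma_ge0 t (ge1 t Tt)) ascent
  (fun t Tt => v_step t (ge1 t Tt)) (fun t Tt => G_step t (ge1 t Tt)) v_bound K0
  gamma_cvg beta_cvg
  (fun s B Ts => series_tail_unbounded gamma_ge0 gamma_sum B (ge1 s Ts)) regular.
(* Compactness again: times at which [q] is at distance at least [e] from all zeros of the gap of
   the centroid, while [G] tends to [0], would produce a cluster point that is such a zero. *)
have near_zero e : 0 < e -> exists T, forall t, (T <= t)%N -> exists l,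
    [/\ DeltaN Y l, gap Y u (centroid C l) = 0 & l1dist (q t) l < e].
  move=> e0; apply: contrapT => nT.
  have /choice[s sP] : forall k, exists t, [/\ (1 <= t)%N, `|G t| < k.+1%:R^-1 &
      ~ exists l, [/\ DeltaN Y l, gap Y u (centroid C l) = 0 & l1dist (q t) l < e]].
    move=> k; apply: contrapT => nt; apply: nT.
    have k0 : 0 < k.+1%:R^-1 :> R by rewrite invr_gt0.
    have [T T0T GT] := G_cvg _ k0; exists T => t Tt.
    apply: contrapT => nl; apply: nt; exists t.
    have t1 : (1 <= t)%N by exact/ge1/(leq_trans T0T).
    by split=> //; rewrite ger0_norm ?GT // gap_ge0 //; exact: Dc.
  have Dx k : DeltaN Y (q (s k)) by have [/Dqt] := sP k.
  have [l Dl xl] := @DeltaN_compact _ _ _ _ _ \oo _ _ Dx.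
  have [k _ kl] := xl setT e filterT e0.
  have [_ _] := sP k; apply; exists l; split=> //.
  by apply: (cluster_zero capL nm0 Dx Dl xl) => j; have [] := sP j.
(* The same [l] serves both claims, since taking centroids does not increase [l1dist]. *)
split; apply: dist_set_cvg0 => e /near_zero[T zT].
  exists T => t /zT[l [Dl gl ql]]; exists l => //; exact: gap0_MCE.
exists (maxn 1 T) => t; rewrite geq_max => /andP[t1 /zT[l [Dl gl ql]]].
exists (centroid C l); first exact: gap0_SNE.
by rewrite qbarE // (le_lt_trans (l1dist_centroid hC _ _)).
Qed.
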